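(* For any base $b\ge 2$ and for any (finite) string $I$ of base $b$ digits, there exist infinitely many $b$-Niven numbers that contain the string $I$ in their base $b$ representation.
   Context: A positive integer $N$ is a $b$-Niven number if $N$ is divisible by the sum of its base $b$ digits. A number contains the string $I$ in its base $b$ representation if $I$ occurs as a block of consecutive digits in that representation. *)

(* Defs.v *)
From mathcomp Require Import all_boot.
From mathcomp Require Import classical_sets cardinality.

Set Implicit Arguments.
Unset Strict Implicit.
Unset Printing Implicit Defensive.

(* Most significant digit first. The first argument is fuel; every step strictly
   decreases a positive [n] when [1 < b], so [n] units are enough. *)
Fixpoint digits_rec (fuel b n : nat) : seq nat :=
  if fuel is k.+1 then
    if n == 0 then [::] else rcons (digits_rec k b (n %/ b)) (n %% b)
  else [::].

(* Meaningful for [1 < b]; [digits b 0] is the empty sequence. *)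
Definition digits (b n : nat) : seq nat := digits_rec n b n.

(* The three lemmas below characterize [digits b n] as the standard base [b]
   representation: [n] is its value, its entries are digits, and it has no
   leading zero. *)
Lemma digits_value b n :
  1 < b -> foldl (fun v d => v * b + d) 0 (digits b n) = n.
Proof.
move=> b1; rewrite /digits.
suff H k m : m <= k -> foldl (fun v d => v * b + d) 0 (digits_rec k b m) = m.
  exact: H.
elim: k m => [|k IH] m /=; first by rewrite leqn0 => /eqP.
have [-> //|m0] := eqVneq m 0; move=> lemk.
have lt : m %/ b < m by rewrite ltn_Pdiv // lt0n.
by rewrite foldl_rcons IH -?divn_eq // -ltnS (leq_trans lt).
Qed.

Lemma digits_lt b n : 1 < b -> all (fun d => d < b) (digits b n).
Proof.
move=> b1; rewrite /digits.
suff H k m : all (fun d => d < b) (digits_rec k b m) by exact: H.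
elim: k m => [|k IH] m //=.
by case: eqP => // _; rewrite all_rcons IH ltn_mod ltnW.
Qed.

Lemma digits_head b n : 1 < b -> 0 < n -> head 0 (digits b n) != 0.
Proof.
move=> b1; rewrite /digits.
suff H k m : m <= k -> 0 < m -> head 0 (digits_rec k b m) != 0 by exact: H.
elim: k m => [|k IH] m /=; first by case: m.
move=> lemk m0; rewrite (gtn_eqF m0).
have [lt|ge] := ltnP m b.
  by rewrite divn_small // modn_small //; case: (k) => /= *; rewrite -lt0n.
have d0 : 0 < m %/ b by rewrite divn_gt0 // ltnW.
have lt : m %/ b < m by rewrite ltn_Pdiv.
have := IH _ (leq_trans lt lemk : m %/ b <= k) d0.
by case: (digits_rec _ _ _).
Qed.

Definition niven (b N : nat) : bool := (0 < N) && (sumn (digits b N) %| N).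

Definition contains_string (b : nat) (I : seq nat) (N : nat) : bool :=
  infix I (digits b N).

(* Main.v *)
Require Import Defs.
From mathcomp Require Import all_boot.
From mathcomp Require Import classical_sets cardinality.

Local Open Scope classical_set_scope.

(** If the digit sum of [N] is a power [b ^ m] and [N] ends in [m] zeros, then
    [N] is Niven, since [b ^ m] divides it. Both conditions can be met around
    any string [I]: write [k] ones, then [I], then [m] zeros. The trailing zeros
    leave the digit sum at [k + sumn I], so it suffices to take [m] with
    [sumn I < b ^ m] and [k = b ^ m - sumn I]; as [k > 0], the string has no
    leading zero and is the true base [b] representation of its value
    ([digits_of_digits]). All large [m] are allowed, and the resulting multiples
    of [b ^ m] are unbounded, so there are infinitely many of them. *)

Definition of_digits (b : nat) (s : seq nat) : nat :=
  foldl (fun v d => v * b + d) 0 s.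

Lemma of_digits_rcons b s d : of_digits b (rcons s d) = of_digits b s * b + d.
Proof. by rewrite /of_digits foldl_rcons. Qed.

Lemma digits_rec_fuel b k l n : 1 < b -> n <= k -> n <= l ->
  digits_rec k b n = digits_rec l b n.
Proof.
move=> b1; elim: k l n => [|k IH] [|l] n /=.
- by [].
- by rewrite leqn0 => ->.
- by move=> _; rewrite leqn0 => ->.
case: eqP => // /eqP n0 nk nl.
have lt : n %/ b < n by rewrite ltn_Pdiv // lt0n.
by rewrite (IH l) // -ltnS (leq_trans lt).
Qed.

Lemma digits_step b n : 1 < b -> 0 < n ->
  digits b n = rcons (digits b (n %/ b)) (n %% b).
Proof.
move=> b1; case: n => // n _; rewrite /digits /=; congr rcons.
have lt : n.+1 %/ b < n.+1 by rewrite ltn_Pdiv.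
exact: digits_rec_fuel.
Qed.

(** Uniqueness of the base [b] representation: the last digit of a string is the
    remainder of its value by [b], and the rest of it represents the quotient.
    The head has default value [1] so that the condition excludes leading zeros
    but not the empty string, which represents [0] and starts the induction. *)
Lemma digits_of_digits b s : 1 < b -> all (fun d => d < b) s ->
  head 1 s != 0 -> digits b (of_digits b s) = s.
Proof.
move=> b1; elim/last_ind: s => [//|s d IH].
rewrite all_rcons => /andP[db sb] hd.
have hs : head 1 s != 0 by case: (s) hd.
have b0 : 0 < b by exact: ltnW.
rewrite of_digits_rcons digits_step //.
  by rewrite divnMDl // divn_small // addn0 modnMDl modn_small // IH.
case: (posnP (of_digits b s)) => [v0|v0]; last by rewrite addn_gt0 muln_gt0 v0 b0.
(* A prefix of value [0] is empty, so [d] is the leading digit. *)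
have s0 : s = [::] by rewrite -(IH sb hs) v0.
by move: hd; rewrite v0 s0 /= lt0n.
Qed.

Lemma of_digits_zeros b s m :
  of_digits b (s ++ nseq m 0) = of_digits b s * b ^ m.
Proof.
elim: m s => [|m IH] s; first by rewrite cats0 muln1.
by rewrite /= -cat_rcons IH of_digits_rcons addn0 expnS mulnA.
Qed.

(** A finite set of naturals would be bounded by the sum of its elements. *)
Lemma infinite_set_unbounded (A : set nat) :
  (forall m, exists2 n, A n & m <= n) -> infinite_set A.
Proof.
move=> unb /finite_seqP[s As].
have [n An] := unb (sumn s).+1.
apply/negP; rewrite -leqNgt.
have: n \in s by move: An; rewrite As.
elim: s {As unb An} => //= a s IH; rewrite inE => /orP[/eqP->|/IH ns].
  exact: leq_addr.
exact: leq_trans ns (leq_addl _ _).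
Qed.

Theorem theorem6 (b : nat) (hb : 2 <= b)
    (I : seq nat) (hI : all (fun d => d < b) I) :
  infinite_set [set N : nat | niven b N /\ contains_string b I N].
Proof.
apply: infinite_set_unbounded => n.
(* The exponent [n + sumn I] makes [b ^ m] exceed both the requested lower bound
   and the digit sum of [I]. *)
pose m := n + sumn I; pose k := b ^ m - sumn I.
have mlt : m < b ^ m by exact: ltn_expl.
have Ilt : sumn I < b ^ m by apply: leq_ltn_trans mlt; exact: leq_addl.
have k0 : 0 < k by rewrite subn_gt0.
pose s := (nseq k 1 ++ I) ++ nseq m 0.
have ds : digits b (of_digits b s) = s.
  apply: digits_of_digits => //; last by rewrite /s; case: (k) k0.
  by rewrite !all_cat hI !all_nseq hb (ltnW hb) !orbT.
have sum_s : sumn s = b ^ m.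
  by rewrite !sumn_cat !sumn_nseq mul1n mul0n addn0 subnK // ltnW.
have N0 : 0 < of_digits b s.
  rewrite lt0n; apply/eqP => N0; move: sum_s; rewrite -ds N0 /= => e.
  by rewrite -e in mlt.
have bN : b ^ m %| of_digits b s by rewrite of_digits_zeros dvdn_mull.
exists (of_digits b s).
  split; first by rewrite /niven N0 ds sum_s.
  by rewrite /contains_string ds /s -catA infix_infix.
apply: leq_trans (dvdn_leq N0 bN); apply: leq_trans (ltnW mlt).
exact: leq_addr.
Qed.
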